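(* Let $p$ be a prime, and let $K=\{k_1,k_2,\ldots,k_r\}$ and $L=\{l_1,l_2,\ldots,l_s\}$ be two disjoint subsets of $\{0,1,\ldots,p-1\}$ (with $r=|K|\ge1$, $s=|L|$). Let $\mathcal{A}=\{A_1,\ldots,A_m\}$ be a family of distinct subsets of $[n]$ such that $|A_i|\pmod p\in K$ for every $i$ and $|A_i\cap A_j|\pmod p\in L$ for every $i\ne j$. If $n\ge 2s-2r+1$, then \[ |\mathcal{A}|\le \binom{n-1}{s}+\binom{n-1}{s-1}+\cdots+\binom{n-1}{s-2r+1}. \]
   Context: Binomial coefficients $\binom{a}{b}$ with $b<0$ are interpreted as $0$. *)

(* Defs.v *)
From mathcomp Require Import all_boot.
Set Implicit Arguments.
Unset Strict Implicit.
Unset Printing Implicit Defensive.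

Definition res_in (p : nat) (K : {set 'I_p}) (x : nat) : Prop :=
  exists2 k : 'I_p, k \in K & x %% p = nat_of_ord k.

(* Main.v *)
Require Import Defs.
From mathcomp Require Import all_boot.
From mathcomp Require Import all_algebra zify.

Set Implicit Arguments.
Unset Strict Implicit.
Unset Printing Implicit Defensive.

Import GRing.Theory.

(** Fix a point [x0], let [U] be its complement and read sets as points of the
    cube over [F_p]. With [s = #|L|] and [r = #|K|], the functions
    [f_B(X) = \prod_(l in L) (|X :&: B :&: U| + [x0 \in B] - l)] for [B] in the
    family depend only on [X :&: U] and have degree at most [s]. They are
    triangular on the family once the sets containing [x0] are put first. Put
    [h(X) = \prod_(z in Z) (|X :&: U| - z)] with [Z = K] union [K - 1]: it has
    degree at most [2r] and vanishes on the family, since [|A :&: U|] is [|A|] or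
    [|A| - 1]. So the products of [h] with the monomials [x_I], [I] inside [U],
    [|I| <= s - 2r], can be added to the [f_B] without losing independence as
    soon as they are independent among themselves, and the bound is the number
    of monomials of degree at most [s] in [n - 1] variables minus the number of
    those of degree at most [s - 2r]. Independence means that a polynomial of
    degree at most [d = s - 2r] vanishing on all layers [|X| mod p] outside [Z]
    is zero. Its antisymmetrisation under exchanging two points has smaller
    degree on a cube with two fewer variables, hence is zero by induction; the
    polynomial is therefore symmetric, i.e. a polynomial in [|X|] of degree at
    most [d], and it has at least [d + 1] roots. *)

(** * Dimension bound by counting over a finite field *)

Section LinearIndependence.

Variables (R : finFieldType) (I J : finType) (M : I -> J -> R).

(** The map [a |-> a M] from [R^I] to [R^J] is additive with trivial kernel, hence injective;
    comparing cardinalities replaces a rank argument. *)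
Lemma leq_card_of_free :
  (forall a : I -> R,
     (forall j, \sum_i a i * M i j = 0)%R -> forall i, a i = 0%R) ->
  #|I| <= #|J|.
Proof.
move=> free.
pose phi (a : {ffun I -> R}) : {ffun J -> R} := [ffun j => \sum_i a i * M i j]%R.
have phi_inj : injective phi.
  move=> a b eq_ab; apply/ffunP => i; apply/eqP; rewrite -subr_eq0; apply/eqP.
  apply: (free (fun i => a i - b i)%R) => j.
  have := congr1 (fun f : {ffun J -> R} => f j) eq_ab; rewrite !ffunE => e.
  under eq_bigr do rewrite mulrBl.
  by rewrite sumrB e subrr.
have := leq_card phi phi_inj.
by rewrite !card_ffun leq_exp2l // card_finNzRing_gt1.
Qed.

End LinearIndependence.

(** * Multilinear polynomials of bounded degree on the cube *)

Section Multilinear.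

Variables (R : fieldType) (T : finType).
Implicit Types (I J X U : {set T}) (f g : {set T} -> R).

Local Open Scope ring_scope.

Definition small_subsets U (d : nat) := [set I : {set T} | I \subset U & (#|I| <= d)%N].

(* [X] is read as a 0/1 point and [I] as the monomial [\prod_(i in I) x_i]. *)
Definition multilinear U (d : nat) f :=
  exists c : {set T} -> R,
    forall X, f X = \sum_(I in small_subsets U d) c I * (I \subset X)%:R.

Lemma multilinear_ext U d f g : f =1 g -> multilinear U d f -> multilinear U d g.
Proof. by move=> e [c cP]; exists c => X; rewrite -e. Qed.

Lemma multilinear_monomial U d I :
  I \in small_subsets U d -> multilinear U d (fun X => (I \subset X)%:R).
Proof.
move=> IU; exists (fun J => (J == I)%:R) => X.
rewrite (bigD1 I) //= eqxx mul1r big1 ?addr0 // => J /andP[_ /negbTE->].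
by rewrite mul0r.
Qed.

Lemma multilinearZ U d a f : multilinear U d f -> multilinear U d (fun X => a * f X).
Proof.
case=> c cP; exists (fun I => a * c I) => X.
by rewrite cP mulr_sumr; apply: eq_bigr => I _; rewrite mulrA.
Qed.

Lemma multilinearD U d f g :
  multilinear U d f -> multilinear U d g -> multilinear U d (fun X => f X + g X).
Proof.
case=> [c cP] [c' cP']; exists (fun I => c I + c' I) => X.
by rewrite cP cP' -big_split; apply: eq_bigr => I _; rewrite mulrDl.
Qed.

Lemma multilinear_sum U d (S : finType) (P : pred S) (F : S -> {set T} -> R) :
  (forall i, P i -> multilinear U d (F i)) ->
  multilinear U d (fun X => \sum_(i | P i) F i X).
Proof.
move=> FP.
have: forall s : seq S, multilinear U d (fun X => \sum_(i <- s | P i) F i X).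
  elim=> [|i s IHs].
    exists (fun=> 0) => X; rewrite big_nil big1 // => I _; exact: mul0r.
  case Pi: (P i).
    apply: multilinear_ext (multilinearD (FP i Pi) IHs) => X.
    by rewrite big_cons Pi.
  by apply: multilinear_ext IHs => X; rewrite big_cons Pi.
exact.
Qed.

Lemma multilinear_leq U d e f : (d <= e)%N -> multilinear U d f -> multilinear U e f.
Proof.
move=> de [c cP].
apply: (@multilinear_ext _ _ (fun X => \sum_(I in small_subsets U d) c I * (I \subset X)%:R)).
  by move=> X; rewrite cP.
apply: multilinear_sum => I; rewrite inE => /andP[IU Id].
by apply/multilinearZ/multilinear_monomial; rewrite inE IU (leq_trans Id).
Qed.

Lemma multilinear_cst U d (a : R) : multilinear U d (fun=> a).
Proof.
have s0 : set0 \in small_subsets U d by rewrite inE sub0set cards0.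
apply: multilinear_ext (multilinearZ a (multilinear_monomial s0)) => X.
by rewrite sub0set mulr1.
Qed.

(** On 0/1 points the monomials of [I] and [J] multiply to that of [I :|: J], so degrees at most
    add. *)
Lemma multilinearM U d e f g :
  multilinear U d f -> multilinear U e g ->
  multilinear U (d + e)%N (fun X => f X * g X).
Proof.
move=> [c cP] [c' cP'].
apply: (@multilinear_ext _ _ (fun X =>
  \sum_(I in small_subsets U d) \sum_(J in small_subsets U e)
     (c I * c' J) * (I :|: J \subset X)%:R)) => [X|].
  rewrite cP cP' big_distrl; apply: eq_bigr => I _ /=.
  rewrite big_distrr; apply: eq_bigr => J _ /=.
  by rewrite subUset -mulnb natrM mulrACA.
apply: multilinear_sum => I; rewrite inE => /andP[IU Id].
apply: multilinear_sum => J; rewrite inE => /andP[JU Je].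
apply/multilinearZ/multilinear_monomial.
rewrite inE subUset IU JU /=.
exact: leq_trans (leq_card_setU I J) (leq_add Id Je).
Qed.

Lemma multilinear_prod U (S : finType) (D : {set S}) (F : S -> {set T} -> R) :
  (forall i, i \in D -> multilinear U 1 (F i)) ->
  multilinear U #|D| (fun X => \prod_(i in D) F i X).
Proof.
move=> FP.
have [s us sD] : exists2 s, uniq s & s =i D.
  by exists (enum D); [exact: enum_uniq | exact: mem_enum].
have -> : #|D| = size s by rewrite -(card_uniqP us); apply/eq_card => i; rewrite sD.
suff: multilinear U (size s) (fun X => \prod_(i <- s) F i X).
  apply: multilinear_ext => X; rewrite big_uniq //=.
  by apply: eq_bigl => i; rewrite sD.
have {us sD} : {subset s <= D} by move=> i; rewrite sD.
elim: s => [|i s IHs] sD.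
  by apply: multilinear_ext (multilinear_cst U 0 1) => X; rewrite big_nil.
have iD : i \in D by apply: sD; rewrite mem_head.
have sD' : {subset s <= D} by move=> j js; apply: sD; rewrite inE js orbT.
by apply: multilinear_ext (multilinearM (FP i iD) (IHs sD')) => X; rewrite big_cons.
Qed.

Lemma multilinear_card U (A : {set T}) (a : R) :
  A \subset U -> multilinear U 1 (fun X => #|X :&: A|%:R + a).
Proof.
move=> AU; apply: multilinearD; last exact: multilinear_cst.
apply: (@multilinear_ext _ _ (fun X => \sum_(i in A) ([set i] \subset X)%:R)).
  move=> X; rewrite -natr_sum; congr (_%:R).
  rewrite -sum1_card big_mkcond [RHS]big_mkcond /=.
  by apply: eq_bigr => i _; rewrite sub1set !inE andbC; case: (i \in A); case: (i \in X).
apply: multilinear_sum => i iA; apply: multilinear_monomial.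
by rewrite inE sub1set cards1 (subsetP AU).
Qed.

End Multilinear.

(** * Subset sums and exchanges of points *)

Section SubsetSums.

Variables (R : fieldType) (T : finType).
Implicit Types (I J X U : {set T}) (c : {set T} -> R).

Local Open Scope ring_scope.

(** Moebius inversion: by induction the proper subsets of [I] have zero coefficient, so the sum at
    [I] is [c I]. *)
Lemma subset_sums_eq0 c U :
  (forall X, X \subset U -> \sum_(I : {set T} | I \subset X) c I = 0) ->
  forall I, I \subset U -> c I = 0.
Proof.
move=> c0 I; have [k] := ubnP #|I|; elim: k I => // k IHk I Ik IU.
have := c0 I IU; rewrite (bigD1 I) //= big1 ?addr0 // => J /andP[JI nJI].
have pJI : J \proper I by rewrite properEneq nJI.
apply: IHk (subset_trans JI IU); exact: leq_trans (proper_card pJI) _.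
Qed.

Lemma sum_subsets_setU1 c a X : a \notin X ->
  \sum_(I : {set T} | I \subset a |: X) c I =
  \sum_(I : {set T} | I \subset X) c I + \sum_(I : {set T} | I \subset X) c (a |: I).
Proof.
move=> aX; rewrite (bigID (fun I : {set T} => a \notin I)) /=; congr (_ + _).
  apply: eq_bigl => I; apply/idP/idP => [/andP[IX aI]|IX].
    by rewrite -(setU1K aX) subsetD1 IX.
  rewrite (subset_trans IX (subsetU1 _ _)) /=.
  by apply: contra aX; apply: (subsetP IX).
rewrite (reindex_onto (fun I => a |: I) (fun I => I :\ a)) /=; last first.
  by move=> I /andP[_ aI]; rewrite setD1K // -[_ \in _]negbK.
apply: eq_bigl => I; rewrite setU11 andbT.
have [aI|aI] := boolP (a \in I).
  rewrite [RHS](contraNF _ aX); last by move/subsetP/(_ a aI).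
  apply: contraTF aI => /andP[_ /eqP<-]; by rewrite !inE eqxx.
rewrite setU1K // eqxx andbT; apply/idP/idP => [IX|]; last exact: setUS.
by rewrite -(setU1K aX) subsetD1 aI andbT (subset_trans (subsetU1 a I) IX).
Qed.

(** Swapping a point of [I :\: J] for one of [J :\: I] keeps the size and shrinks [I :\: J]. *)
Lemma exchange_invariant_card (S : Type) (f : {set T} -> S) U :
  (forall a b J, a \in U -> b \in U -> a != b -> J \subset U :\ a :\ b ->
     f (a |: J) = f (b |: J)) ->
  forall I J, I \subset U -> J \subset U -> #|I| = #|J| -> f I = f J.
Proof.
move=> fU I J; have [k] := ubnP #|I :\: J|; elim: k I => // k IHk I Ik IU JU eqIJ.
have [IJ|/subsetPn[a aI aJ]] := boolP (I \subset J).
  by congr f; apply/eqP; rewrite eqEcard IJ eqIJ leqnn.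
have [JI|/subsetPn[b bJ bI]] := boolP (J \subset I).
  by congr f; apply/esym/eqP; rewrite eqEcard JI eqIJ leqnn.
have nab : a != b by apply: contraNneq aJ => ->.
have bIa : b \notin I :\ a by rewrite inE negb_and bI orbT.
have aU := subsetP IU a aI; have bU := subsetP JU b bJ.
rewrite -[in LHS](setD1K aI) (fU a b) //; last first.
  by rewrite subsetD1 bIa andbT setSD.
apply: IHk => //.
- apply: leq_trans (_ : #|I :\: J| <= k)%N; last by rewrite -ltnS.
  apply: proper_card; apply/properP; split.
    apply/subsetP => x; rewrite !inE => /andP[xJ].
    by case/orP => [/eqP xb|/andP[_ ->]]; [rewrite xb bJ in xJ | rewrite xJ].
  exists a; first by rewrite !inE aI aJ.
  by rewrite !inE eqxx (negbTE nab) andbF.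
- by rewrite subUset sub1set bU (subset_trans (subsetDl _ _) IU).
- by rewrite cardsU1 bIa -eqIJ (cardsD1 a I) aI.
Qed.

End SubsetSums.

Lemma card_subsets_of_card (T : finType) (U : {set T}) k :
  #|[set I : {set T} | I \subset U & #|I| == k]| = 'C(#|U|, k).
Proof. by rewrite -cards_draws; apply: eq_card => I; rewrite !inE. Qed.

(** * Low-degree polynomials vanishing on layers modulo [p] *)

Section PrimeField.

Variables (p : nat) (p_pr : prime p).

Local Open Scope ring_scope.

Lemma natr_Fp_eq (a b : nat) : (a%:R == b%:R :> 'F_p) = (a == b %[mod p]).
Proof.
apply/eqP/eqP => [/(congr1 val)|e]; first by rewrite /= !val_Fp_nat.
by apply: val_inj; rewrite /= !val_Fp_nat.
Qed.

(** The falling factorial divided by the factorial of [i], which is invertible because [i < p]. *)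
Lemma bin_poly (i : nat) : (i < p)%N ->
  exists2 P : {poly 'F_p}, (size P <= i.+1)%N & forall m : nat, P.[m%:R] = 'C(m, i)%:R.
Proof.
move=> ip.
pose Q : {poly 'F_p} := \prod_(0 <= j < i) ('X - (j%:R)%:P).
have fact_neq0 : (i`!)%:R != 0 :> 'F_p.
  rewrite -(dvdn_pcharf (pchar_Fp p_pr)).
  elim: i ip {Q} => [|i IHi] ip; first by rewrite Euclid_dvd1.
  by rewrite factS Euclid_dvdM // negb_or gtnNdvd //= IHi // ltnW.
exists ((i`!)%:R^-1 *: Q).
  apply: leq_trans (size_scale_leq _ _) _.
  by rewrite size_prod_XsubC size_iota subn0.
move=> m; rewrite hornerZ; apply: (mulfI fact_neq0).
rewrite mulrA divff // mul1r -natrM mulnC bin_ffact /Q.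
elim: i {ip Q fact_neq0} => [|i IHi]; first by rewrite big_nil hornerC.
rewrite big_nat_recr //= hornerM IHi hornerXsubC ffactnSr natrM.
have [le_im|lt_mi] := leqP i m; first by rewrite natrB.
by rewrite ffact_small // !mul0r.
Qed.

(** Coefficients depending only on [#|I|] make the sum at [X] a combination of the ['C(#|X|, i)]
    with [i <= d], hence a polynomial of degree at most [d] in [#|X|]. *)
Lemma symmetric_subset_sums_vanish (T : finType) (Z : {set 'F_p}) (d m : nat)
    (U : {set T}) (c : {set T} -> 'F_p) :
  (d + #|Z| < p)%N -> (d + #|Z| <= #|U|)%N ->
  (forall I : {set T}, I \subset U -> (d < #|I|)%N -> c I = 0) ->
  (forall I J : {set T}, I \subset U -> J \subset U -> #|I| = #|J| -> c I = c J) ->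
  (forall X : {set T}, X \subset U -> (#|X| + m)%:R \notin Z -> \sum_(I : {set T} | I \subset X) c I = 0) ->
  forall I : {set T}, I \subset U -> c I = 0.
Proof.
move=> dZp dZU cd csym cZ.
have [P P_size PE] : exists2 P : {poly 'F_p}, (size P <= d.+1)%N &
    forall X : {set T}, X \subset U -> P.[#|X|%:R] = \sum_(I : {set T} | I \subset X) c I.
  (* The default 0 is reached only for [i > #|U|]. *)
  pose g (i : nat) := if [pick I : {set T} | (I \subset U) && (#|I| == i)] is Some J then c J else 0.
  have gE (I : {set T}) : I \subset U -> c I = g #|I|.
    move=> IU; rewrite /g; case: pickP => [J /andP[JU /eqP eJ]|/(_ I)].
      exact: csym.
    by rewrite IU eqxx.
  have [B BP] : exists B : 'I_d.+1 -> {poly 'F_p}, forall i : 'I_d.+1,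
      (size (B i) <= i.+1)%N /\ forall k : nat, (B i).[k%:R] = 'C(k, i)%:R.
    apply: (fin_all_exists (P := fun (i : 'I_d.+1) (Q : {poly 'F_p}) =>
      (size Q <= i.+1)%N /\ forall k : nat, Q.[k%:R] = 'C(k, i)%:R)) => i.
    have [|Q ? ?] := @bin_poly i; last by exists Q.
    by apply: leq_ltn_trans dZp; rewrite (leq_trans _ (leq_addr _ _)) // -ltnS.
  exists (\sum_(i < d.+1) g i *: B i).
    apply: (leq_trans (size_sum _ _ _)); apply/bigmax_leqP => i _.
    apply: leq_trans (size_scale_leq _ _) _.
    by apply: leq_trans (proj1 (BP i)) _.
  move=> X XU; rewrite horner_sum.
  rewrite (bigID (fun I : {set T} => #|I| < d.+1)%N) /= [X in _ + X]big1 ?addr0; last first.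
    by move=> I /andP[IX]; rewrite -leqNgt => Id; rewrite cd // (subset_trans IX).
  rewrite (partition_big (fun I : {set T} => inord #|I| : 'I_d.+1) xpredT) //=.
  apply: eq_bigr => i _; rewrite hornerZ (proj2 (BP i)).
  rewrite -card_subsets_of_card -sum1_card natr_sum mulr_sumr.
  under [LHS]eq_bigl do rewrite inE.
  symmetry; rewrite (eq_bigl (fun I : {set T} => (I \subset X) && (#|I| == i))).
    apply: eq_bigr => I /andP[IX /eqP <-]; rewrite mulr1 gE //.
    exact: subset_trans IX XU.
  move=> I; rewrite -andbA; congr (_ && _).
  apply/andP/eqP => [[Id /eqP <-]|eI]; first by rewrite inordK.
  by rewrite eI ltn_ord; split=> //; apply/eqP/val_inj; rewrite /= inordK.
have natr_inj : {in gtn p &, injective (fun k : nat => k%:R : 'F_p)}.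
  move=> j k; rewrite !inE => jp kp /eqP; rewrite natr_Fp_eq.
  by rewrite !modn_small // => /eqP.
(* The sizes up to [d + #|Z|] are distinct modulo [p] and occur inside [U]; at most [#|Z|] are
   excluded, leaving [d + 1] roots. *)
pose s := [seq k%:R : 'F_p | k <- iota 0 (d + #|Z|).+1 & (k + m)%:R \notin Z].
have s_uniq : uniq s.
  rewrite map_inj_in_uniq ?filter_uniq ?iota_uniq // => j k.
  rewrite !mem_filter !mem_iota => /andP[_ jd] /andP[_ kd].
  by apply: natr_inj; rewrite inE; lia.
have s_size : (d < size s)%N.
  rewrite size_map size_filter.
  have := count_predC (fun k : nat => (k + m)%:R \in Z) (iota 0 (d + #|Z|).+1).
  rewrite size_iota -size_filter; set t := filter _ _ => count_t.
  suff st : (size t <= #|Z|)%N.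
    rewrite -(ltn_add2l (size t)) [X in (_ < X)%N]count_t ltnS addnC.
    by rewrite leq_add2l.
  have -> : size t = size [seq (k + m)%:R : 'F_p | k <- t] by rewrite size_map.
  rewrite cardE; apply: uniq_leq_size.
    rewrite map_inj_in_uniq ?filter_uniq ?iota_uniq // => j k.
    rewrite !mem_filter !mem_iota => /andP[_ jd] /andP[_ kd].
    by rewrite !natrD => /addIr; apply: natr_inj; rewrite inE; lia.
  by move=> _ /mapP[k + ->]; rewrite mem_filter mem_enum => /andP[].
have P0 : P = 0.
  apply/eqP/negP => /negP P_neq0.
  suff : (size s < size P)%N by rewrite ltnNge (leq_trans P_size).
  apply: max_poly_roots s_uniq => //; apply/allP => _ /mapP[k + ->].
  rewrite mem_filter mem_iota add0n => /andP[kZ /andP[_ kd]].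
  have [X XU Xk] : exists2 X : {set T}, X \subset U & #|X| = k.
    have : (0 < #|[set X : {set T} | X \subset U & #|X| == k]|)%N.
      by rewrite card_subsets_of_card bin_gt0; apply: leq_trans dZU.
    by case/card_gt0P => X; rewrite inE => /andP[XU /eqP Xk]; exists X.
  by rewrite rootE -Xk PE // cZ // Xk.
by apply: subset_sums_eq0 => X XU; rewrite -PE // P0 horner0.
Qed.

(* Exchanging two points [a], [b] lowers the degree by one and the ground set by
   two, so by induction [c] is invariant under exchanges. *)
Lemma subset_sums_vanish (T : finType) (Z : {set 'F_p}) (d m : nat) (U : {set T})
    (c : {set T} -> 'F_p) :
  (d + #|Z| < p)%N -> (2 * d + #|Z| <= #|U|)%N ->
  (forall I : {set T}, I \subset U -> (d < #|I|)%N -> c I = 0) ->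
  (forall X : {set T}, X \subset U -> (#|X| + m)%:R \notin Z -> \sum_(I : {set T} | I \subset X) c I = 0) ->
  forall I : {set T}, I \subset U -> c I = 0.
Proof.
elim: d m U c => [|d IHd] m U c dZp dZU cd cZ;
  apply: (symmetric_subset_sums_vanish dZp _ cd _ cZ);
  try (by apply: leq_trans dZU; lia); apply: exchange_invariant_card.
  (* In degree 0 both sets are nonempty, so both coefficients vanish. *)
  move=> a b J aU bU nab; rewrite !subsetD1 => /andP[/andP[JU aJ] bJ].
  by rewrite !cd ?cardsU1 ?aJ ?bJ // subUset sub1set JU ?aU ?bU.
move=> a b J aU bU nab JU'; apply/eqP; rewrite -subr_eq0; apply/eqP.
have sub' (X : {set T}) : X \subset U :\ a :\ b -> [/\ X \subset U, a \notin X & b \notin X].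
  by rewrite !subsetD1 => /andP[/andP[-> ->] ->].
(* Adjoining [a] or [b] adds one to the size of [X], whence the shift [m.+1]. *)
apply: (IHd m.+1 (U :\ a :\ b) (fun J => c (a |: J) - c (b |: J))) JU'.
- by rewrite ltnW.
- have := cardsD1 a U; have := cardsD1 b (U :\ a).
  rewrite aU !inE bU eq_sym nab /= => eb ea; move: dZU; rewrite ea eb.
  by move: #|_ :\ b| #|Z| => u z; lia.
- move=> I /sub'[IU aI bI] dI.
  by rewrite !cd ?subrr // ?cardsU1 ?aI ?bI // subUset sub1set IU ?aU ?bU.
- move=> X /sub'[XU aX bX]; rewrite addnS => XZ; rewrite sumrB.
  have eXa := sum_subsets_setU1 c aX; have eXb := sum_subsets_setU1 c bX.
  have eX e : e \in U -> e \notin X -> \sum_(I : {set T} | I \subset e |: X) c I = 0.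
    by move=> eU eX; rewrite cZ ?cardsU1 ?eX // subUset sub1set XU eU.
  apply/eqP; rewrite subr_eq0; apply/eqP.
  by apply: (addrI (\sum_(I : {set T} | I \subset X) c I)); rewrite -eXa -eXb !eX.
Qed.

End PrimeField.

(** A relation between coefficient vectors is one between the functions, so the coefficient matrix
    has independent rows. *)
Lemma leq_card_multilinear_free (R : finFieldType) (S T : finType) (U : {set T}) (d : nat)
    (f : S -> {set T} -> R) :
  (forall i, multilinear U d (f i)) ->
  (forall a : S -> R, (forall X, \sum_i a i * f i X = 0)%R -> forall i, a i = 0%R) ->
  #|S| <= #|small_subsets U d|.
Proof.
move=> /fin_all_exists[c cP] free.
rewrite -[X in _ <= X]card_sig.
apply: (@leq_card_of_free R _ _ (fun i (J : {J | J \in small_subsets U d}) => c i (val J))).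
move=> a aM; apply: free => X.
under eq_bigr do rewrite cP mulr_sumr.
rewrite exchange_big big1 //= => J HJ.
under eq_bigr do rewrite mulrA.
by rewrite -mulr_suml (aM (Sub J HJ)) mul0r.
Qed.

(** * The independent system attached to the family *)

Section ModularIntersections.

Variables (p : nat) (T : finType) (x0 : T) (K L : {set 'F_p}) (F : {set {set T}}).

Hypotheses (p_pr : prime p) (KL : [disjoint K & L]) (K_gt0 : 0 < #|K|).
Hypothesis FK : forall A, A \in F -> (#|A|%:R)%R \in K.
Hypothesis FL : forall A B, A \in F -> B \in F -> A != B -> (#|A :&: B|%:R)%R \in L.
Hypothesis KLT : 2 * #|L| + 1 <= #|T| + 2 * #|K|.

Local Open Scope ring_scope.

Let U := [set~ x0].
Let Z := K :|: [set k - 1 | k in K].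
(** The additive form makes [G] empty, rather than [[set set0]], when [#|L| < 2 * #|K|]. *)
Let G := [set I : {set T} | I \subset U & (#|I| + 2 * #|K| <= #|L|)%N].

Let f (B X : {set T}) : 'F_p :=
  \prod_(l in L) (#|X :&: (B :&: U)|%:R + ((x0 \in B)%:R - l)).
Let h (X : {set T}) : 'F_p := \prod_(z in Z) (#|X :&: U|%:R + - z).

Let card_setIU (A : {set T}) : (#|A|%:R = #|A :&: U|%:R + (x0 \in A)%:R :> 'F_p)%R.
Proof. by rewrite -natrD addnC /U -setDE -cardsD1. Qed.

Let card_Z : (#|Z| <= 2 * #|K|)%N.
Proof.
rewrite mul2n -addnn; apply: leq_trans (leq_card_setU _ _) _.
by rewrite leq_add2l; apply: leq_imset_card.
Qed.

Let card_KL : (#|K| + #|L| <= p)%N.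
Proof.
have := leq_card_setU K L; rewrite KL => /leqifP/eqP <-.
by apply: leq_trans (max_card _) _; rewrite card_Fp.
Qed.

Let h_eq0 (A : {set T}) : A \in F -> h A = 0.
Proof.
move=> AF; have kK := FK AF; set k := _%:R in kK.
have zZ : #|A :&: U|%:R \in Z.
  rewrite (_ : _%:R = k - (x0 \in A)%:R); last by rewrite /k (card_setIU A) addrK.
  by case: (x0 \in A); rewrite ?subr0 !inE ?kK //; apply/orP; right; apply/imsetP; exists k.
by rewrite /h (bigD1 _ zZ) /= subrr mul0r.
Qed.

(** The constant in [f B] is the contribution of [x0] to [#|A :&: B|], provided [x0 \in B] forces
    [x0 \in A]. *)
Let f_cardI (A B : {set T}) : (x0 \in B -> x0 \in A) -> f B A = \prod_(l in L) (#|A :&: B|%:R - l).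
Proof.
move=> BA; apply: eq_bigr => l _; rewrite addrA (card_setIU (A :&: B)) setIA inE.
by case: (boolP (x0 \in B)) => [/BA->|]; rewrite ?andbF.
Qed.

Let f_eq0 (A B : {set T}) : A \in F -> B \in F -> A != B -> (x0 \in B -> x0 \in A) -> f B A = 0.
Proof.
move=> AF BF nAB /f_cardI ->; have lL := FL AF BF nAB.
by rewrite (bigD1 _ lL) /= subrr mul0r.
Qed.

Let f_neq0 (A : {set T}) : A \in F -> f A A != 0.
Proof.
move=> AF; rewrite f_cardI // setIid; apply/prodf_neq0 => l lL.
rewrite subr_eq0; apply: contraTneq lL => <-.
by rewrite (disjointFr KL) // FK.
Qed.

(* The functions [f B] form a triangular system on [F], the sets containing [x0]
   coming first, while [h] vanishes on [F]. *)
Lemma card_modular_family : (#|F| + #|G| <= #|small_subsets U #|L| |)%N.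
Proof.
pose S := ({A | A \in F} + {I | I \in G})%type.
pose phi (i : S) (X : {set T}) : 'F_p :=
  match i with inl A => f (val A) X | inr J => h X * (val J \subset X)%:R end.
have -> : (#|F| + #|G|)%N = #|{: S}| by rewrite card_sum !card_sig.
apply: (@leq_card_multilinear_free _ _ _ _ _ phi).
  case=> [[A AF]|[I IG]] /=.
    by apply: multilinear_prod => l _; apply/multilinear_card/subsetIr.
  have := IG; rewrite inE => /andP[IU IL].
  have ZIL : (#|Z| + #|I| <= #|L|)%N by move: card_Z IL; lia.
  apply: (multilinear_leq ZIL); apply: multilinearM.
    by apply: multilinear_prod => z _; apply: multilinear_card.
  by apply: multilinear_monomial; rewrite inE IU /=.
move=> a a0.
have a0l X : X \in F -> \sum_(A : {A | A \in F}) a (inl A) * f (val A) X = 0.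
  move=> XF; have := a0 X; rewrite big_sumType /= [X in _ + X]big1 ?addr0 // => I _.
  by rewrite h_eq0 // mul0r mulr0.
have al_x0 (A : {A | A \in F}) : x0 \in val A -> a (inl A) = 0.
  move=> x0A; have := a0l _ (valP A); rewrite (bigD1 A) //= big1 ?addr0 => [|B nBA].
    by move/eqP; rewrite mulf_eq0 (negbTE (f_neq0 (valP A))) orbF => /eqP.
  by rewrite f_eq0 ?mulr0 ?(valP A) ?(valP B) // eq_sym.
(* Sets [B] containing [x0] already have coefficient zero; for the others [f_eq0] applies at [A]. *)
have al (A : {A | A \in F}) : a (inl A) = 0.
  have [/al_x0 //|x0A] := boolP (x0 \in val A).
  have := a0l _ (valP A); rewrite (bigD1 A) //= big1 ?addr0 => [|B nBA].
    by move/eqP; rewrite mulf_eq0 (negbTE (f_neq0 (valP A))) orbF => /eqP.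
  have [/al_x0 ->|x0B] := boolP (x0 \in val B); first by rewrite mul0r.
  by rewrite f_eq0 ?mulr0 ?(valP A) ?(valP B) 1?eq_sym // (negbTE x0B).
case=> // I; have := valP I; rewrite inE => /andP[IU IL].
(* Coefficients extended by zero; dividing the relation by [h X], nonzero off [Z], leaves their
   subset sums. *)
pose c (J : {set T}) := oapp (fun J => a (inr J)) 0 (insub J : option {I | I \in G}).
have <- : c (val I) = a (inr I) by rewrite /c valK.
apply: (@subset_sums_vanish p p_pr T Z (#|L| - 2 * #|K|) 0 U) => //.
(* Since [2 * #|K| <= #|L|] by [IL], the subtraction is exact and
   [d + #|Z| <= #|L| <= p - #|K| < p]. *)
- by move: card_Z card_KL K_gt0 IL; move: #|Z| #|K| #|L| #|val I| => *; lia.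
(* Here [2 * d + #|Z| <= 2 * #|L| - 2 * #|K| <= #|T| - 1], by [KLT]. *)
- by rewrite cardsC1; move: card_Z KLT IL; move: #|Z| #|K| #|L| #|T| #|val I| => *; lia.
- move=> J JU dJ; rewrite /c insubN // inE JU /=.
  by move: dJ; move: #|J| #|K| #|L| => *; lia.
move=> X XU; rewrite addn0 => XZ.
have hX : h X != 0.
  apply/prodf_neq0 => z zZ; rewrite (setIidPl XU) subr_eq0.
  by apply: contraNneq XZ => ->.
apply: (mulfI hX); rewrite mulr0 -[RHS](a0 X) big_sumType /=.
rewrite [X in X + _]big1 ?add0r => [|A _]; last by rewrite al mul0r.
transitivity (\sum_(J in G) c J * (h X * (J \subset X)%:R)); last first.
  by rewrite big_sub; apply: eq_bigr => J _; rewrite /c valK.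
rewrite mulr_sumr big_mkcond [RHS]big_mkcond; apply: eq_bigr => J _.
have [JG|JG] := boolP (J \in G); last by rewrite /c insubN // mulr0; case: ifP.
by case: ifP; rewrite ?mulr1 ?mulr0 // mulrC.
Qed.

End ModularIntersections.

(** * Counting layers and the final bound *)

Lemma card_small_subsets (T : finType) (U : {set T}) (s t : nat) :
  #|small_subsets U s| =
  #|[set I : {set T} | I \subset U & #|I| + t <= s]| +
  \sum_(i < t | i <= s) 'C(#|U|, s - i).
Proof.
elim: t => [|t IHt].
  by rewrite big_ord0 addn0; apply: eq_card => I; rewrite !inE addn0.
rewrite {}IHt big_mkcond [in RHS]big_mkcond big_ord_recr /= addnA addnAC.
(* The layer of size [s - t] is split off. If [s < t] it is empty, and the guard drops a binomial
   that truncated subtraction would turn into ['C(_, 0) = 1]. *)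
congr (_ + _); rewrite -(cardsID [set I : {set T} | #|I| + t == s]) addnC.
congr (_ + _).
  by apply: eq_card => I; rewrite !inE addnS ltn_neqAle andbCA.
case: leqP => [ts|st].
  rewrite -card_subsets_of_card; apply: eq_card => I; rewrite !inE -andbA.
  by congr (_ && _); apply/andP/eqP => [[_ /eqP]|]; lia.
by apply: eq_card0 => I; rewrite !inE; apply/negP => /andP[_ /eqP]; lia.
Qed.

Theorem theorem2p11 (p n : nat) (K L : {set 'I_p}) (F : {set {set 'I_n}}) :
  prime p ->
  [disjoint K & L] ->
  0 < #|K| ->
  (forall A, A \in F -> res_in K #|A|) ->
  (forall A B, A \in F -> B \in F -> A != B -> res_in L #|A :&: B|) ->
  2 * #|L| + 1 <= n + 2 * #|K| ->
  #|F| <= \sum_(i < 2 * #|K| | i <= #|L|) 'C(n.-1, #|L| - i).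
Proof.
move=> p_pr KL K_gt0 FK FL KLn.
(* For [n = 0] there is no point to fix; the family has at most one member and the term [i = #|L|]
   equals 1. *)
have [n0|n_gt0] := posnP n.
  have sK : #|L| < 2 * #|K| by lia.
  rewrite (bigD1 (Ordinal sK)) //= subnn bin0 (leq_trans _ (leq_addr _ _)) //.
  have := subset_leq_card (subsetT F).
  by rewrite -powersetT card_powerset cardsT card_ord [in 2 ^ _]n0.
pose toF (k : 'I_p) : 'F_p := (k%:R)%R.
have toF_inj : injective toF.
  move=> j k /eqP; rewrite /toF natr_Fp_eq // !modn_small // => /eqP.
  exact: val_inj.
have resF (D : {set 'I_p}) x : res_in D x -> ((x%:R)%R : 'F_p) \in toF @: D.
  case=> k kD xk; apply/imsetP; exists k => //.
  by apply/eqP; rewrite natr_Fp_eq // xk modn_small.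
have := @card_modular_family p 'I_n (Ordinal n_gt0) (toF @: K) (toF @: L) F p_pr.
(* The number of sets in [G] now appears on both sides and cancels. *)
rewrite !card_imset // imset_disjoint // (card_small_subsets _ _ (2 * #|K|)).
rewrite cardsC1 card_ord (addnC #|F|) leq_add2l; apply=> //.
- by move=> A AF; apply/resF/FK.
- by move=> A B AF BF nAB; apply/resF/FL.
Qed.
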